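(* Let $G$ be a countably infinite discrete group, let $X \in VN(G)$ with $E(X) = 0$, and let $\epsilon < 1$. If $G$ can be partitioned into finitely many subsets $\{ A_l: 1 \le l \le L \}$ such that for $1 \le l \le L$, $\| P_{A_l}XP_{A_l}\| \le \epsilon \|X\|$, then $G$ can be partitioned into $K$ syndetic subsets $\{ S_k: 1 \le k \le K \}$ with $K \le L$ such that for $1 \le k \le K$, $\| P_{S_k}XP_{S_k} \| \le \epsilon \|X\|$.
   Context: Let $\ell^2(G)$ be the Hilbert space of square-summable functions on $G$, with orthonormal basis $\{e_g : g \in G\}$, where $e_g$ is $1$ at $g$ and $0$ elsewhere, and let $B(\ell^2(G))$ be the bounded operators on it. The left regular representation $\lambda: G \to B(\ell^2(G))$ is $\lambda(g)e_h = e_{gh}$, and $VN(G) = \lambda(G)''$ (double commutant) is the von Neumann algebra of $G$. An operator $X$ is identified with the matrix $(x_{g,h})$, $x_{g,h} = \langle Xe_h, e_g\rangle$, and $E(X)$ denotes the diagonal part of $X$, i.e. the diagonal operator with $E(X)e_g = x_{g,g}e_g$. For $A \subseteq G$, $P_A$ is the diagonal projection with $P_A e_h = e_h$ if $h \in A$ and $P_A e_h = 0$ otherwise. Norms are operator norms. A subset $S \subseteq G$ is called syndetic if there exists a finite set $F \subseteq G$ such that $G = \bigcup_{g \in F} g^{-1}S$. *)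

(* Defs.v *)
From HB Require Import structures.
From mathcomp Require Import all_boot all_order all_algebra.
From mathcomp Require Import complex ring.
From mathcomp Require Import all_classical all_reals all_analysis.

Set Implicit Arguments.
Unset Strict Implicit.
Unset Printing Implicit Defensive.

Import Order.TTheory GRing.Theory Num.Theory.
Import Normc.

Local Open Scope classical_set_scope.
Local Open Scope ring_scope.
Local Open Scope complex_scope.

(* [normc : R[i] -> R] is the real-valued modulus of [complex.v]; the norm
   [`|z|] of the numeric field R[i] takes its values in R[i]. *)
Section square_summable.
Variables (R : realType) (G : choiceType).
Implicit Types (f h : G -> R[i]) (z w : R[i]).

Lemma normc_ge0 z : 0 <= normc z.
Proof. by case: z => a b; rewrite sqrtr_ge0. Qed.

Lemma normc_sqr z : normc z ^+ 2 = complex.Re z ^+ 2 + complex.Im z ^+ 2.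
Proof. by case: z => a b; rewrite sqr_sqrtr ?addr_ge0 ?sqr_ge0. Qed.

Definition sqnorm f : \bar R :=
  (\esum_(g in [set: G]) (normc (f g) ^+ 2)%:E)%E.

Definition square_summable : {pred G -> R[i]} :=
  fun f => `[< (sqnorm f < +oo)%E >].

Lemma square_summableP f : reflect (sqnorm f < +oo)%E (f \in square_summable).
Proof. exact: asboolP. Qed.

Lemma sqnorm_ge0 f : (0 <= sqnorm f)%E.
Proof. by apply: esum_ge0 => g _; rewrite lee_fin sqr_ge0. Qed.

Lemma le_sqnormM (c : R) f h : 0 <= c ->
  (forall g, normc (f g) <= c * normc (h g)) ->
  (sqnorm f <= (c ^+ 2)%:E * sqnorm h)%E.
Proof.
move=> c0 fh; apply: ub_ereal_sup => _ [A [finA _] <-].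
apply: (@le_trans _ _
  ((c ^+ 2)%:E * \sum_(x \in A) (normc (h x) ^+ 2)%:E)%E); last first.
  apply: lee_wpmul2l; first by rewrite lee_fin sqr_ge0.
  by apply: ereal_sup_ubound; exists A.
rewrite ge0_mule_fsumr; last by move=> g; rewrite lee_fin sqr_ge0.
apply: lee_fsum => // g _; rewrite -EFinM lee_fin -exprMn.
by rewrite ler_pXn2r ?nnegrE ?mulr_ge0 ?normc_ge0.
Qed.

Lemma square_summable_submod : submod_closed square_summable.
Proof.
split=> [|a f h /square_summableP ff /square_summableP hh].
  apply/square_summableP; rewrite /sqnorm esum1 ?ltry// => g _.
  by rewrite [X in normc X](_ : _ = 0)// normc0 expr0n.
apply/square_summableP.
have aff : (sqnorm (fun g => (a * f g)%R) < +oo)%E.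
  apply: (@le_lt_trans _ _ ((normc a ^+ 2)%:E * sqnorm f)%E).
    by apply: le_sqnormM => [|g]; rewrite ?normc_ge0// normcM.
  rewrite lte_mul_pinfty// ?lee_fin ?sqr_ge0//.
apply: (@le_lt_trans _ _
  (2%:E * sqnorm (fun g => (a * f g)%R) + 2%:E * sqnorm h)%E); last first.
  by rewrite lte_add_pinfty// lte_mul_pinfty.
apply: ub_ereal_sup => _ [A [finA _] <-].
apply: (@le_trans _ _
  (2%:E * \sum_(x \in A) (normc (a * f x)%R ^+ 2)%:E +
   2%:E * \sum_(x \in A) (normc (h x) ^+ 2)%:E)%E); last first.
  by apply: leeD; (apply: lee_wpmul2l => //; apply: ereal_sup_ubound; exists A).
rewrite !ge0_mule_fsumr; try by move=> g; rewrite lee_fin sqr_ge0.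
rewrite -fsbig_split//=; apply: lee_fsum => // g _.
rewrite -!EFinM -EFinD lee_fin [X in normc X ^+ 2 <= _](_ : _ = a * f g + h g)//.
move: (a * f g) (h g) => [u v] [s t]; rewrite !normc_sqr /=.
rewrite -subr_ge0.
have -> : 2 * (u ^+ 2 + v ^+ 2) + 2 * (s ^+ 2 + t ^+ 2)
          - ((u + s) ^+ 2 + (v + t) ^+ 2) = (u - s) ^+ 2 + (v - t) ^+ 2.
  by ring.
by rewrite addr_ge0 ?sqr_ge0.
Qed.

HB.instance Definition _ :=
  GRing.isSubmodClosed.Build R[i] (G -> R[i]) square_summable
    (GRing.submod_closed_semi square_summable_submod).

Record ell2 := Ell2 { ell2_fun :> G -> R[i] ; _ : ell2_fun \in square_summable }.

HB.instance Definition _ := [isSub for ell2_fun].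
HB.instance Definition _ := [Choice of ell2 by <:].
HB.instance Definition _ := [SubChoice_isSubLmodule of ell2 by <:].

End square_summable.

Section ell2_theory.
Variables (R : realType) (G : choiceType).
Local Notation ell2 := (ell2 R G).
Implicit Types (x y : ell2) (g h : G).

Lemma ell2_eqP x y : (forall g, x g = y g) -> x = y.
Proof. by move=> xy; apply: val_inj; apply/funext. Qed.

Lemma ell2_sqnorm_lty x : (sqnorm x < +oo)%E.
Proof. by apply/square_summableP; case: x. Qed.

Definition ell2norm x : R := Num.sqrt (fine (sqnorm x)).

Lemma sqr_ell2norm x : (ell2norm x ^+ 2)%:E = sqnorm x.
Proof.
rewrite /ell2norm sqr_sqrtr ?fine_ge0 ?sqnorm_ge0// fineK//.
by rewrite ge0_fin_numE ?sqnorm_ge0 ?ell2_sqnorm_lty.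
Qed.

Lemma ell2norm_ge0 x : 0 <= ell2norm x. Proof. exact: sqrtr_ge0. Qed.

Lemma le_ell2normM (c : R) x y : 0 <= c ->
  (forall g, normc (x g) <= c * normc (y g)) -> ell2norm x <= c * ell2norm y.
Proof.
move=> c0 xy; rewrite -(@ler_pXn2r _ 2) ?nnegrE ?mulr_ge0 ?ell2norm_ge0//.
by rewrite exprMn -lee_fin [leRHS]EFinM !sqr_ell2norm; exact: le_sqnormM.
Qed.

Lemma normc_le_ell2norm x g : normc (x g) <= ell2norm x.
Proof.
rewrite -(@ler_pXn2r _ 2) ?nnegrE ?ell2norm_ge0 ?normc_ge0//.
rewrite -lee_fin sqr_ell2norm /sqnorm.
rewrite -(@esum_set1 _ _ g (fun h => (normc (x h) ^+ 2)%:E)) ?lee_fin ?sqr_ge0//.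
by apply: esum_ge; exists [set g]; rewrite ?esum_fset// => h _; rewrite lee_fin sqr_ge0.
Qed.

(* The sum of an absolutely summable real family, as the sum of its positive
   part minus that of its negative part; meaningless otherwise. *)
Definition rsum (u : G -> R) : R :=
  fine (\esum_(g in [set: G]) ((EFin \o u)^\+ g) -
        \esum_(g in [set: G]) ((EFin \o u)^\- g))%E.

Definition csum (f : G -> R[i]) : R[i] :=
  rsum (fun g => complex.Re (f g)) +i* rsum (fun g => complex.Im (f g)).

(* Linear in the first variable. *)
Definition inner x y : R[i] := csum (fun g => x g * (y g)^*%C).

Lemma esum_supp1 (g : G) (a : G -> \bar R) : (0 <= a g)%E ->
  (forall h, h != g -> a h = 0%E) -> (\esum_(h in [set: G]) a h = a g)%E.
Proof.
move=> ag0 a0; have age0 h : (0 <= a h)%E by have [->|/a0->] := eqVneq h g.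
rewrite (esumID [set g])// !setTI esum_set1// esum1 ?adde0// => h /= hg.
by apply: a0; apply/eqP.
Qed.

Lemma rsum_supp1 (g : G) (u : G -> R) :
  (forall h, h != g -> u h = 0) -> rsum u = u g.
Proof.
move=> u0; rewrite /rsum !(@esum_supp1 g) ?funepos_ge0 ?funeneg_ge0//.
- by have /(congr1 (fun F => fine (F g))) := funeposneg (EFin \o u).
- by move=> h /u0 uh; rewrite funenegE /= uh oppr0 maxxx.
- by move=> h /u0 uh; rewrite funeposE /= uh maxxx.
Qed.

Lemma ell2norm_inner x : inner x x = (ell2norm x ^+ 2)%:C.
Proof.
have E g : x g * (x g)^*%C = (normc (x g) ^+ 2)%:C.
  by rewrite -sqr_normc normc_def -rmorphXn /= normc_sqr sqr_sqrtr
             ?addr_ge0 ?sqr_ge0.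
rewrite /inner /csum; congr (_ +i* _).
  rewrite /rsum [X in (_ - X)%E]esum1 ?sube0; last first.
    move=> g _; rewrite funenegE /= E /=; apply/max_idPr.
    by rewrite lee_fin oppr_le0 sqr_ge0.
  apply: EFin_inj; rewrite sqr_ell2norm.
  under eq_esum do rewrite funeposE /= E/= -EFin_max max_l ?sqr_ge0//.
  by rewrite fineK// ge0_fin_numE ?sqnorm_ge0 ?ell2_sqnorm_lty.
rewrite /rsum !esum1 ?sube0// => g _.
- by rewrite funenegE /= E /= oppr0 maxxx.
- by rewrite funeposE /= E /= maxxx.
Qed.

Definition delta_fun (g : G) : G -> R[i] := fun h => (h == g)%:R.

Lemma delta_fun_summable g : delta_fun g \in @square_summable R G.
Proof.
apply/square_summableP; rewrite /sqnorm (@esum_supp1 g) ?ltry ?lee_fin ?sqr_ge0//.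
by move=> h /negbTE hg; rewrite /delta_fun hg normc0 expr0n.
Qed.

Definition delta (g : G) : ell2 := Ell2 (delta_fun_summable g).

Lemma deltaE g h : delta g h = (h == g)%:R. Proof. by []. Qed.

Lemma inner_delta x g : inner x (delta g) = x g.
Proof.
have E h : h != g -> x h * (delta g h)^*%C = 0.
  by move=> /negbTE hg; rewrite deltaE hg rmorph0 mulr0.
rewrite /inner /csum !(@rsum_supp1 g); try by move=> h /E ->.
by rewrite deltaE eqxx rmorph1 mulr1; case: (x g).
Qed.

Lemma ell2norm_delta g : ell2norm (delta g) = 1.
Proof.
rewrite /ell2norm /sqnorm (@esum_supp1 g) ?lee_fin ?sqr_ge0//.
  by rewrite /= /delta_fun eqxx normc1 expr1n sqrtr1.
by move=> h /negbTE hg; rewrite /= /delta_fun hg normc0 expr0n.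
Qed.

End ell2_theory.
Arguments delta {R G} g.

Section operators.
Variables (R : realType) (G : choiceType).
Implicit Types (x y : ell2 R G) (g h : G).

Record bop := Bop {
  bop_fun :> {linear ell2 R G -> ell2 R G} ;
  bop_bounded : exists M : R, forall x, ell2norm (bop_fun x) <= M * ell2norm x }.

Lemma bop_eqP (S T : bop) : (forall x, S x = T x) -> S = T.
Proof.
case: S T => [S bS] [T bT] /= ST.
have {}ST : S = T.
  case: S T ST {bS bT} => [S [[p1] [p2]]] [T [[q1] [q2]]] /= /funext ST.
  by subst T; rewrite (Prop_irrelevance p1 q1) (Prop_irrelevance p2 q2).
by subst T; congr Bop; exact: Prop_irrelevance.
Qed.

Definition opnorm (T : bop) : R :=
  sup [set ell2norm (T x) | x in [set x | ell2norm x <= 1]].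

Lemma bop_has_bound (T : bop) :
  exists2 M : R, 0 <= M & forall x, ell2norm (T x) <= M * ell2norm x.
Proof.
case: (bop_bounded T) => M TM; exists `|M| => // x.
by apply: le_trans (TM x) _; rewrite ler_wpM2r ?ell2norm_ge0 ?ler_norm.
Qed.

Lemma opnorm_le (T : bop) x : ell2norm (T x) <= opnorm T * ell2norm x.
Proof.
have [M M0 TM] := bop_has_bound T.
have T1 y : ell2norm y <= 1 -> ell2norm (T y) <= opnorm T.
  move=> y1; apply: ub_le_sup; last by exists y.
  by exists M => _ [z /= z1 <-]; rewrite (le_trans (TM z))// ler_piMr.
have := ell2norm_ge0 x; rewrite le_eqVlt => /predU1P[x0|x0].
  by rewrite -x0 mulr0; have := TM x; rewrite -x0 mulr0.
rewrite -ler_pdivrMr// mulrC.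
have nV (a : R) : 0 < a -> normc a%:C = a.
  by move=> a0; rewrite /= expr0n addr0 sqrtr_sqr gtr0_norm.
have sc (a : R) y : 0 < a -> ell2norm (a%:C *: y) <= a * ell2norm y.
  move=> a0; apply: le_ell2normM => [|g]; first exact: ltW.
  by rewrite [X in normc X](_ : _ = a%:C * y g)// normcM nV.
have := T1 ((ell2norm x)^-1%:C *: x).
have Vx0 : 0 < (ell2norm x)^-1 by rewrite invr_gt0.
move=> /(_ _)/le_trans; rewrite linearZ /=.
set u := T x; have := sc (ell2norm x) ((ell2norm x)^-1%:C *: u) x0.
rewrite scalerA -rmorphM /= divff ?gt_eqF// scale1r => ux.
move=> h; rewrite ler_pdivrMl//; apply: le_trans ux _.
rewrite ler_pM2l//; apply: h (lexx _).
by rewrite (le_trans (sc _ _ Vx0))// mulVf ?gt_eqF.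
Qed.

Lemma zero_bop_bounded :
  exists M : R, forall x, ell2norm ((\0 : {linear ell2 R G -> ell2 R G}) x)
                            <= M * ell2norm x.
Proof.
exists 0 => x; apply: le_ell2normM => // g.
by rewrite mul0r [X in normc X](_ : _ = 0)// normc0.
Qed.

Definition bop0 : bop := Bop zero_bop_bounded.

Lemma comp_bop_bounded (S T : bop) :
  exists M : R, forall x, ell2norm ((S \o T) x) <= M * ell2norm x.
Proof.
have [[M M0 SM] [N N0 TN]] := (bop_has_bound S, bop_has_bound T).
exists (M * N) => x; apply: le_trans (SM _) _.
by rewrite -mulrA ler_wpM2l.
Qed.

Definition bop_comp (S T : bop) : bop := Bop (comp_bop_bounded S T).

Section diagonal.
Variable w : G -> R[i].

Definition bounded_weight := exists M : R, forall g, normc (w g) <= M.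

Hypothesis bw : bounded_weight.

Lemma diag_bound :
  exists2 M : R, 0 <= M & forall g (z : R[i]), normc (w g * z) <= M * normc z.
Proof.
case: bw => M wM; exists `|M| => // g z; rewrite normcM.
by rewrite ler_wpM2r ?normc_ge0// (le_trans (wM g)) ?ler_norm.
Qed.

Lemma diag_summable x : (fun g => w g * x g) \in @square_summable R G.
Proof.
have [M M0 wM] := diag_bound; apply/square_summableP.
apply: (@le_lt_trans _ _ ((M ^+ 2)%:E * sqnorm x)%E); first exact: le_sqnormM.
by rewrite lte_mul_pinfty ?lee_fin ?sqr_ge0 ?ell2_sqnorm_lty.
Qed.

Definition diag_fun x : ell2 R G := Ell2 (diag_summable x).

Lemma diag_fun_linear : linear diag_fun.
Proof.
move=> a x y; apply: ell2_eqP => g /=.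
rewrite [LHS](_ : _ = w g * (a * x g + y g))//.
rewrite [RHS](_ : _ = a * (w g * x g) + w g * y g)//.
by rewrite mulrDr mulrCA.
Qed.

HB.instance Definition _ :=
  GRing.isLinear.Build R[i] (ell2 R G) (ell2 R G) _ diag_fun diag_fun_linear.

Lemma diag_fun_bounded :
  exists M : R, forall x, ell2norm (diag_fun x) <= M * ell2norm x.
Proof.
have [M M0 wM] := diag_bound; exists M => x.
by apply: le_ell2normM => // g; exact: wM.
Qed.

Definition diag_bop : bop := Bop diag_fun_bounded.

Lemma diag_bop_delta h : diag_bop (delta h) = w h *: delta h.
Proof.
apply: ell2_eqP => g.
rewrite [LHS](_ : _ = w g * (g == h)%:R)//.
rewrite [RHS](_ : _ = w h * (g == h)%:R)//.
by have [->|_] := eqVneq g h; rewrite ?mulr0.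
Qed.

End diagonal.

Lemma indic_bounded (A : set G) : bounded_weight (\1_A : G -> R[i]).
Proof.
exists 1 => g; rewrite indicE; case: (g \in A); first by rewrite normc1.
by rewrite normc0 ler01.
Qed.

Definition diag_proj (A : set G) : bop := diag_bop (indic_bounded A).

Lemma diag_proj_delta (A : set G) h : diag_proj A (delta h) = if h \in A then delta h else 0.
Proof. by rewrite diag_bop_delta indicE; case: ifP; rewrite ?scale1r ?scale0r. Qed.

Definition entry (T : bop) (g h : G) : R[i] := inner (T (delta h)) (delta g).

Lemma entry_diag_bounded (T : bop) : bounded_weight (fun g => entry T g g).
Proof.
have [M _ TM] := bop_has_bound T; exists M => g; rewrite /entry inner_delta.
by rewrite (le_trans (normc_le_ell2norm _ g))// (le_trans (TM _))// ell2norm_delta mulr1.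
Qed.

Definition diag_part (T : bop) : bop := diag_bop (entry_diag_bounded T).

Definition commutant (S : set bop) : set bop :=
  [set T | forall Y, S Y -> bop_comp T Y = bop_comp Y T].

End operators.
Arguments diag_proj {R G} A.
Arguments bop0 {R G}.

Section group_von_neumann.
Variables (R : realType) (G : groupType).
Implicit Types (x y : ell2 R G) (g h k : G).

Lemma sqnorm_translate g x : sqnorm (fun h => x (g^-1 * h)%g) = sqnorm x.
Proof.
rewrite /sqnorm (@reindex_esum _ _ _ setT setT (fun h => (g^-1 * h)%g)
                   (fun h => (normc (x h) ^+ 2)%:E))//.
split=> // [h k _ _ /= /mulgI //|h _]; exists (g * h)%g => //.
by rewrite mulKg.
Qed.

Lemma translate_summable g x :
  (fun h => x (g^-1 * h)%g) \in @square_summable R G.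
Proof. by apply/square_summableP; rewrite sqnorm_translate ell2_sqnorm_lty. Qed.

Definition translate g x : ell2 R G := Ell2 (translate_summable g x).

Lemma translate_linear g : linear (translate g).
Proof. by move=> a x y; apply: ell2_eqP. Qed.

HB.instance Definition _ g :=
  GRing.isLinear.Build R[i] (ell2 R G) (ell2 R G) _ (translate g)
    (translate_linear g).

Lemma translate_bounded g :
  exists M : R, forall x, ell2norm (translate g x) <= M * ell2norm x.
Proof. by exists 1 => x; rewrite mul1r /ell2norm sqnorm_translate. Qed.

Definition lreg g : bop R G := Bop (translate_bounded g).

Lemma lreg_delta g h : lreg g (delta h) = delta (g * h)%g.
Proof.
apply: ell2_eqP => k; rewrite [LHS](_ : _ = (g^-1 * k == h)%g%:R)// deltaE.
by rewrite -(inj_eq (mulgI g)) mulVKg.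
Qed.

Definition VN : set (bop R G) := commutant (commutant (range lreg)).

Definition syndetic (S : set G) : Prop :=
  exists F : set G, finite_set F /\
    [set: G] = \bigcup_(g in F) [set (g^-1 * s)%g | s in S].

End group_von_neumann.

(* Main.v *)
Require Import Defs.
From HB Require Import structures.
From mathcomp Require Import all_boot all_order all_algebra.
From mathcomp Require Import complex.
From mathcomp Require Import all_classical all_reals all_analysis.
From mathcomp Require Import ring.
Import Order.TTheory GRing.Theory Num.Theory.
Local Open Scope classical_set_scope.
Local Open Scope ring_scope.

(** A partition is a colouring of [G], and the paving bound for a colour class
    [B] depends only on its finite subsets and is invariant under right
    translation, because [X] commutes with the right regular representation.
    Hence it passes to any pointwise limit of right translates of a colouring.
    If the class of colour [l] is not syndetic, then for every finite [F] some
    right translate of the colouring avoids [l] on [F]; a limit of such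
    translates along an ultrafilter avoids [l] everywhere. So a colour can be
    discarded as long as one of the classes is not syndetic. *)

(** * Triangle inequality and finite truncation in [ell2] *)

Section ell2_norm.
Context {R : realType} {G : choiceType}.
Implicit Types (x y : ell2 R G) (E B : set G).

(** At each point the right side minus the left is $|bx-ay|^2/(ab)$. With $a=\|x\|$ and $b=\|y\|$
    the bound becomes $(\|x\|+\|y\|)^2$, which yields the triangle inequality. *)
Lemma sqnormD_le {a b : R} x y : 0 < a -> 0 < b ->
  (sqnorm (x + y)%R <= ((a + b) / a)%:E * sqnorm x + ((a + b) / b)%:E * sqnorm y)%E.
Proof.
move=> a0 b0; apply: ge_ereal_sup => _ [A [finA _] <-].
have ca : 0 <= (a + b) / a by rewrite divr_ge0 ?addr_ge0 ?ltW.
have cb : 0 <= (a + b) / b by rewrite divr_ge0 ?addr_ge0 ?ltW.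
apply: (@le_trans _ _
  (((a + b) / a)%:E * \sum_(i \in A) (Normc.normc (x i) ^+ 2)%:E +
   ((a + b) / b)%:E * \sum_(i \in A) (Normc.normc (y i) ^+ 2)%:E)%E); last first.
  by apply: leeD; (apply: lee_wpmul2l => //; apply: ereal_sup_ubound; exists A).
rewrite !ge0_mule_fsumr; try by move=> g; rewrite lee_fin sqr_ge0.
rewrite -fsbig_split//=; apply: lee_fsum => // g _.
rewrite -!EFinM -EFinD lee_fin.
rewrite [X in Normc.normc X ^+ 2 <= _](_ : _ = x g + y g)//.
move: (x g) (y g) => [u v] [s t]; rewrite !normc_sqr /= -subr_ge0.
have -> : (a + b) / a * (u ^+ 2 + v ^+ 2) + (a + b) / b * (s ^+ 2 + t ^+ 2)
    - ((u + s) ^+ 2 + (v + t) ^+ 2)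
  = ((b * u - a * s) ^+ 2 + (b * v - a * t) ^+ 2) / (a * b).
  by field; rewrite !gt_eqF.
by rewrite divr_ge0 ?addr_ge0 ?sqr_ge0// mulr_ge0// ltW.
Qed.

Lemma ell2norm0 : ell2norm (0 : ell2 R G) = 0.
Proof.
apply/eqP; rewrite eq_le ell2norm_ge0 andbT.
rewrite -[leRHS](mul0r (ell2norm (0 : ell2 R G))); apply: le_ell2normM => // g.
by rewrite mul0r [X in Normc.normc X](_ : _ = 0)// Normc.normc0.
Qed.

Lemma ell2norm_eq0 x : ell2norm x = 0 -> x = 0.
Proof.
move=> x0; apply: ell2_eqP => g; apply: Normc.eq0_normc.
by apply/eqP; rewrite eq_le normc_ge0 andbT -x0 normc_le_ell2norm.
Qed.

Lemma ell2normD x y : ell2norm (x + y) <= ell2norm x + ell2norm y.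
Proof.
have := ell2norm_ge0 x; rewrite le_eqVlt => /predU1P[/esym x0|x0].
  by rewrite x0 (ell2norm_eq0 _ x0) !add0r.
have := ell2norm_ge0 y; rewrite le_eqVlt => /predU1P[/esym y0|y0].
  by rewrite y0 (ell2norm_eq0 _ y0) !addr0.
rewrite -(@ler_pXn2r _ 2) ?nnegrE ?addr_ge0 ?ell2norm_ge0//.
rewrite -lee_fin sqr_ell2norm (le_trans (sqnormD_le x y x0 y0))//.
rewrite -!sqr_ell2norm -!EFinM -EFinD lee_fin le_eqVlt; apply/orP; left.
by apply/eqP; field; rewrite !gt_eqF.
Qed.

Lemma diag_projE B x g : diag_proj B x g = if g \in B then x g else 0.
Proof.
rewrite [LHS](_ : _ = \1_B g * x g)// indicE.
by case: (g \in B); rewrite ?mul1r ?mul0r.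
Qed.

Lemma ell2norm_diag_proj B x : ell2norm (diag_proj B x) <= ell2norm x.
Proof.
rewrite -[leRHS]mul1r; apply: le_ell2normM => // g; rewrite mul1r diag_projE.
by case: ifP => // _; rewrite Normc.normc0 normc_ge0.
Qed.

Lemma ell2norm_le_finite {x} {a : R} : 0 <= a ->
  (forall E, finite_set E -> ell2norm (diag_proj E x) <= a) -> ell2norm x <= a.
Proof.
move=> a0 xa; rewrite -(@ler_pXn2r _ 2) ?nnegrE ?ell2norm_ge0//.
rewrite -lee_fin sqr_ell2norm; apply: ge_ereal_sup => _ [E [finE _] <-].
have /xa := finE; rewrite -(@ler_pXn2r _ 2) ?nnegrE ?ell2norm_ge0//.
rewrite -lee_fin sqr_ell2norm; apply: le_trans; apply: esum_ge.
exists E => //; apply: lee_fsum => // g /mem_set Eg.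
by rewrite diag_projE Eg.
Qed.

Lemma ell2norm_tail x {d : R} : 0 < d ->
  exists2 E, finite_set E & ell2norm (diag_proj (~` E) x) <= d.
Proof.
move=> d0; have d20 : 0 < d ^+ 2 by rewrite exprn_gt0.
have finx : sqnorm x \is a fin_num by rewrite -sqr_ell2norm.
(* [E] carries all of [sqnorm x] up to [d ^+ 2]; its complement carries the rest. *)
have [_ [E [finE _] <-] Ed] := ub_ereal_sup_adherent d20 finx.
exists E => //; rewrite -(@ler_pXn2r _ 2) ?nnegrE ?ell2norm_ge0 ?(ltW d0)//.
have sq0 g : (0 <= (Normc.normc (x g) ^+ 2)%:E)%E by rewrite lee_fin sqr_ge0.
have EC : sqnorm (diag_proj (~` E) x) =
    (\esum_(g in ~` E) (Normc.normc (x g) ^+ 2)%:E)%E.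
  rewrite esum_mkcond; apply: eq_esum => g _; rewrite diag_projE.
  by case: ifP => // _; rewrite Normc.normc0 expr0n.
have xE : sqnorm x = ((\sum_(g \in E) (Normc.normc (x g) ^+ 2)%:E) +
    sqnorm (diag_proj (~` E) x))%E.
  by rewrite EC -esum_fset// /sqnorm (esumID E [set: G])// !setTI.
rewrite -lee_fin sqr_ell2norm.
move: Ed; rewrite [ereal_sup _](_ : _ = sqnorm x)// xE -sqr_ell2norm.
(* The partial sum is a real number, so it can be cancelled in the extended reals. *)
have [r ->] : exists r : R, (\sum_(g \in E) (Normc.normc (x g) ^+ 2)%:E = r%:E)%E.
  by exists (\sum_(g \in E) (Normc.normc (x g) ^+ 2)); rewrite fsumEFin.
rewrite -EFinD lte_fin lee_fin ltrBlDr ltrD2l; exact: ltW.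
Qed.

End ell2_norm.

(** * Compressions $P_B X P_B$ and their finite pieces *)

Section compression.
Context {R : realType} {G : choiceType}.
Implicit Types (T X : bop R G) (x : ell2 R G) (B C E : set G).

Lemma opnorm_ge0 T : 0 <= opnorm T.
Proof.
have [M M0 TM] := bop_has_bound T.
apply: le_trans (ell2norm_ge0 (T 0)) _; apply: ub_le_sup.
  by exists M => _ [x /= x1 <-]; rewrite (le_trans (TM x))// ler_piMr.
by exists 0 => //=; rewrite ell2norm0.
Qed.

Lemma opnorm_le_bound T (a : R) : 0 <= a ->
  (forall x, ell2norm (T x) <= a * ell2norm x) -> opnorm T <= a.
Proof.
move=> a0 Ta; apply: ge_sup.
  by exists (ell2norm (T 0)), 0 => //=; rewrite ell2norm0.
by move=> _ [x /= x1 <-]; rewrite (le_trans (Ta x))// ler_piMr.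
Qed.

Definition compress B X : bop R G :=
  bop_comp (diag_proj B) (bop_comp X (diag_proj B)).

(** For $B \subseteq C$, $P_B X P_B = P_B (P_C X P_C) P_B$, and projections are contractions. *)
Lemma compress_subset {B C} X x : B `<=` C ->
  ell2norm (compress B X x) <= opnorm (compress C X) * ell2norm x.
Proof.
move=> BC.
have E : compress B X x = diag_proj B (compress C X (diag_proj B x)).
  have -> : compress C X (diag_proj B x) =
      diag_proj C (X (diag_proj B x)).
    congr (diag_proj C (X _)); apply: ell2_eqP => g; rewrite !diag_projE.
    by do 2 case: ifPn => //; move=> /set_mem /BC /mem_set ->.
  apply: ell2_eqP => g; rewrite !diag_projE.
  by case: ifPn => // /set_mem /BC /mem_set ->.
rewrite E (le_trans (ell2norm_diag_proj _ _))// (le_trans (opnorm_le _ _))//.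
by rewrite ler_wpM2l ?opnorm_ge0 ?ell2norm_diag_proj.
Qed.

(** Both the output and the input can be truncated to finite sets, the first exactly by a supremum
    and the second up to an arbitrary [e]. *)
Lemma opnorm_compress_finite X B (a : R) : 0 <= a ->
  (forall C x, finite_set C -> C `<=` B ->
     ell2norm (compress C X x) <= a * ell2norm x) ->
  opnorm (compress B X) <= a.
Proof.
move=> a0 Xa; apply: opnorm_le_bound => // x.
apply: ell2norm_le_finite => [|E finE]; first by rewrite mulr_ge0 ?ell2norm_ge0.
apply/ler_addgt0Pr => e e0.
(* The summand 1 keeps the denominator positive even if [X] is zero. *)
have M0 : 0 < opnorm X + 1 by rewrite ltr_wpDl ?opnorm_ge0.
have [E' finE' xE'] := ell2norm_tail x (divr_gt0 e0 M0).
(* Containing $E \cap B$ gives $P_E P_B = P_E P_C$; containing $E' \cap B$ puts $B \setminus C$ in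
   the tail of [x]. *)
pose C := (E `|` E') `&` B.
have finC : finite_set C by apply: finite_setIl; rewrite finite_setU.
have xB : diag_proj B x = diag_proj C x + diag_proj (B `\` C) x.
  apply: ell2_eqP => g.
  rewrite [RHS](_ : _ = diag_proj C x g + diag_proj (B `\` C) x g)//.
  rewrite !diag_projE in_setD.
  have [gC|gC] /= := boolP (g \in C); rewrite ?andbT ?andbF ?addr0 ?add0r//.
  by move: gC; rewrite in_setI => /andP[_ ->].
have tail : ell2norm (diag_proj (B `\` C) x) <= e / (opnorm X + 1).
  apply: le_trans xE'; rewrite -[leRHS]mul1r; apply: le_ell2normM => // g.
  rewrite mul1r !diag_projE; case: ifPn => [|_]; last by rewrite Normc.normc0 normc_ge0.
  rewrite inE => -[Bg Cg]; rewrite mem_set// => E'g.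
  by apply: Cg; split=> //; right.
have -> : diag_proj E (compress B X x) =
    diag_proj E (diag_proj C (X (diag_proj B x))).
  apply: ell2_eqP => g; rewrite !diag_projE; case: ifPn => // gE.
  by rewrite in_setI in_setU gE.
rewrite (le_trans (ell2norm_diag_proj _ _))// xB.
rewrite (linearD (bop_fun X)) (linearD (bop_fun (diag_proj C))).
apply: le_trans (ell2normD _ _) _; apply: lerD.
  by apply: Xa; last exact: subIsetr.
rewrite (le_trans (ell2norm_diag_proj _ _))// (le_trans (opnorm_le _ _))//.
rewrite (le_trans (ler_wpM2l (opnorm_ge0 _) tail))// mulrA ler_pdivrMr// mulrC.
by rewrite ler_pM2l// lerDl.
Qed.

End compression.

(** * Right translations and their commutation with $VN(G)$ *)

Section right_translation.
Context {R : realType} {G : groupType}.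
Implicit Types (X : bop R G) (x : ell2 R G) (g h : G) (B C : set G).

Lemma sqnorm_rtranslate h x : sqnorm (fun g => x (g * h)%g) = sqnorm x.
Proof.
rewrite /sqnorm (@reindex_esum _ _ _ setT setT (fun g => (g * h)%g)
                   (fun g => (Normc.normc (x g) ^+ 2)%:E))//.
split=> // [g k _ _ /= /mulIg //|g _]; exists (g * h^-1)%g => //.
by rewrite mulgVK.
Qed.

Lemma rtranslate_summable h x :
  (fun g => x (g * h)%g) \in @square_summable R G.
Proof. by apply/square_summableP; rewrite sqnorm_rtranslate ell2_sqnorm_lty. Qed.

(** The right regular representation: $e_k \mapsto e_{kh^{-1}}$. *)
Definition rtranslate h x : ell2 R G := Ell2 (rtranslate_summable h x).

Lemma rtranslate_linear h : linear (rtranslate h).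
Proof. by move=> a x y; apply: ell2_eqP. Qed.

HB.instance Definition _ h :=
  GRing.isLinear.Build R[i] (ell2 R G) (ell2 R G) _ (rtranslate h)
    (rtranslate_linear h).

Lemma ell2norm_rtranslate h x : ell2norm (rtranslate h x) = ell2norm x.
Proof. by rewrite /ell2norm sqnorm_rtranslate. Qed.

Lemma rtranslate_bounded h :
  exists M : R, forall x, ell2norm (rtranslate h x) <= M * ell2norm x.
Proof. by exists 1 => x; rewrite mul1r ell2norm_rtranslate. Qed.

Definition rreg h : bop R G := Bop (rtranslate_bounded h).

(** Right translations commute with left ones by associativity, so they lie in $\lambda(G)'$, with
    which the double commutant commutes. *)
Lemma VN_rtranslate X h x : VN X -> X (rtranslate h x) = rtranslate h (X x).
Proof.
move=> /(_ (rreg h)) XV; suff /XV : commutant (range (@lreg R G)) (rreg h).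
  by move=> /(congr1 (fun T : bop R G => T x)).
move=> _ [k _ <-]; apply: bop_eqP => y; apply: ell2_eqP => g.
by rewrite [LHS](_ : _ = y (k^-1 * (g * h))%g)// mulgA.
Qed.

Lemma diag_proj_rtranslate {B C h} x :
  (forall g, C (g * h)%g <-> B g) ->
  diag_proj B (rtranslate h x) = rtranslate h (diag_proj C x).
Proof.
move=> BC; apply: ell2_eqP => g; rewrite diag_projE.
rewrite [RHS](_ : _ = diag_proj C x (g * h)%g)// diag_projE.
suff -> : (g \in B) = ((g * h)%g \in C) by [].
by apply/idP/idP; rewrite !inE => /BC.
Qed.

(** It suffices to treat finite $F \subseteq B$. Some translate $Fh$ lies in [C], and right
    translation by [h] is an isometry conjugating $P_{Fh} X P_{Fh}$ into $P_F X P_F$. The element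
    [h] may depend on [F]. *)
Lemma opnorm_compress_limit X B C : VN X ->
  (forall F, finite_set F -> F `<=` B -> exists h, forall g, F g -> C (g * h)%g) ->
  opnorm (compress B X) <= opnorm (compress C X).
Proof.
move=> XV BC; apply: opnorm_compress_finite => [|F x finF FB].
  exact: opnorm_ge0.
have [h Fh] := BC _ finF FB.
(* This is $Fh$. *)
pose D := [set g | F (g * h^-1)%g].
have DF g : D (g * h)%g <-> F g by rewrite /D /= mulgK.
have DC : D `<=` C by move=> g /Fh; rewrite mulgVK.
have xE : x = rtranslate h (rtranslate h^-1%g x).
  by apply: ell2_eqP => g; rewrite [RHS](_ : _ = x (g * h * h^-1)%g)// mulgK.
have -> : compress F X x = rtranslate h (compress D X (rtranslate h^-1%g x)).
  rewrite {1}xE [LHS]/= (diag_proj_rtranslate _ DF) VN_rtranslate//.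
  by rewrite (diag_proj_rtranslate _ DF).
by rewrite ell2norm_rtranslate (le_trans (compress_subset _ _ DC))//
  ell2norm_rtranslate.
Qed.

End right_translation.

(** * Colourings, their limits, and the elimination of colours *)

Section coloring.
Context {G : groupType}.
Implicit Types (S F : set G).

(** Otherwise each [h] has some $g \in F$ with $gh \in S$, so $h = g^{-1}(gh) \in g^{-1}S$ and [F]
    witnesses syndeticity. *)
Lemma not_syndetic S F : ~ syndetic S -> finite_set F ->
  exists h, forall g, F g -> ~ S (g * h)%g.
Proof.
move=> nS finF; apply: contrapT => FS; apply: nS; exists F; split=> //.
apply/esym/seteqP; split=> // h _.
have [g Fg Sgh] : exists2 g, F g & S (g * h)%g.
  apply: contrapT => nF; apply: FS; exists h => g Fg Sgh.
  by apply: nF; exists g.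
by exists g => //; exists (g * h)%g => //; rewrite mulKg.
Qed.

Lemma limit_coloring {L : finType} (c : G -> L) (l : L) :
  ~ syndetic (c @^-1` [set l]) ->
  exists2 c' : G -> L, forall g, c' g != l &
    forall F, finite_set F -> exists h, forall g, F g -> c (g * h)%g = c' g.
Proof.
move=> nS; pose B F := [set h | forall g, F g -> c (g * h)%g <> l].
(* The sets [B F] are nonempty exactly by the failure of syndeticity, and $B(F \cup F') \subseteq
   B(F) \cap B(F')$. *)
have FB : ProperFilter (filter_from [set F | finite_set F] B).
  apply: filter_from_proper => [|F finF]; last exact: not_syndetic nS finF.
  apply: filter_from_filter => [|F F' finF finF']; first by exists set0; exact: finite_set0.
  exists (F `|` F'); first by rewrite /= finite_setU.
  by move=> h Bh; split=> g Fg; apply: Bh; [left|right].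
have [U [UU BU]] := ultraFilterLemma FB.
have PU := @ultra_proper _ _ UU.
have {}BU F : finite_set F -> U (B F) by move=> finF; apply: BU; exists F.
(* The limit of [c (g * h)] along [U] exists because there are finitely many colours: otherwise the
   complements of all level sets, whose intersection is empty, would belong to [U]. *)
have /choice[c' Uc'] g : exists m, U [set h | c (g * h)%g = m].
  apply: contrapT => nm.
  have /filter_forall/filter_ex[h Uh] :
      forall m, U (~` [set h | c (g * h)%g = m]).
    move=> m; have [Um|//] := in_ultra_setVsetC [set h | c (g * h)%g = m] UU.
    by case: nm; exists m.
  exact: (Uh (c (g * h)%g)).
exists c' => [g|F finF].
  have /filter_ex[h [/= <- /(_ g erefl)/eqP//]] :
      U ([set h | c (g * h)%g = c' g] `&` B [set g]).
    by apply: filterI (Uc' g) _; apply: BU.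
have /filter_ex[h Fh] : U (\bigcap_(g in F) [set h | c (g * h)%g = c' g]).
  by rewrite -(fset_setK finF); apply: filter_bigI => g _; exact: Uc'.
by exists h => g /Fh.
Qed.

(** [partition] demands nonempty blocks; syndeticity of the final classes supplies this. *)
Lemma syndetic_nonempty S : syndetic S -> S !=set0.
Proof.
move=> [F [_ SF]]; have : [set: G] 1%g by [].
by rewrite SF => -[g _ [s Ss _]]; exists s.
Qed.

Lemma coloring_partition {L : nat} (c : G -> 'I_L) :
  (forall l, c @^-1` [set l] !=set0) ->
  partition [set: 'I_L] (fun l => c @^-1` [set l]) [set: G].
Proof.
move=> cs; split=> //; first by apply/seteqP; split=> // g _; exists (c g).
by move=> i j _ _ [g [/= <- <-]].
Qed.

Lemma partition_coloring {L : nat} (A : 'I_L -> set G) :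
  partition [set: 'I_L] A [set: G] ->
  exists c : G -> 'I_L, forall l, c @^-1` [set l] = A l.
Proof.
move=> [cov triv _].
have /choice[c Ac] g : exists l, A l g.
  by have : [set: G] g by []; rewrite -cov => -[l _ Al]; exists l.
exists c => l; apply/seteqP; split=> [g <- //|g Al].
by apply: triv => //; exists g.
Qed.

End coloring.

(** Induction on the number of colours. Colourings may have empty classes here, since passing to a
    limit can empty classes other than the discarded one. *)
Lemma syndetic_coloring {R : realType} {G : groupType} (X : bop R G) (a : R)
    (L : nat) (c : G -> 'I_L) : VN X ->
  (forall l, opnorm (compress (c @^-1` [set l]) X) <= a) ->
  exists (K : nat) (c' : G -> 'I_K),
    [/\ (K <= L)%N, forall k, syndetic (c' @^-1` [set k]) &
      forall k, opnorm (compress (c' @^-1` [set k]) X) <= a].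
Proof.
(* With no colours there is no colouring, as [G] contains 1. *)
move=> XV; elim: L c => [|L IH] c ca; first by case: (c 1%g).
have [syn|/existsNP[l nl]] := pselect (forall l, syndetic (c @^-1` [set l])).
  by exists L.+1, c.
have [c1 c1l cc1] := limit_coloring _ _ nl.
(* [c1] misses [l], so it factors through [lift l] and uses only [L] colours. *)
have /choice[c2 c2E] g : exists k : 'I_L, c1 g = lift l k.
  by have := c1l g; rewrite eq_sym => /unlift_some[k -> _]; exists k.
have [k|K [c' [KL syn c'a]]] := IH c2; last first.
  by exists K, c'; split=> //; exact: leqW.
(* Class [k] of [c2] is class [lift l k] of [c1], a limit of right translates of that class of
   [c]. *)
apply: le_trans (ca (lift l k)); apply: opnorm_compress_limit => // F finF Fk.
have [h Fh] := cc1 _ finF; exists h => g Fg /=.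
by rewrite Fh// c2E (Fk _ Fg).
Qed.

Theorem theorem2p3 (R : realType) (G : groupType)
  (G_countable : countable [set: G]) (G_infinite : infinite_set [set: G])
  (X : bop R G) (X_VN : VN X) (EX0 : diag_part X = bop0)
  (eps : R) (eps_lt1 : eps < 1)
  (L : nat) (A : 'I_L -> set G) (A_partition : partition [set: 'I_L] A [set: G])
  (A_paving : forall l : 'I_L,
     opnorm (bop_comp (diag_proj (A l)) (bop_comp X (diag_proj (A l)))) <= eps * opnorm X) :
  exists (K : nat) (S : 'I_K -> set G),
    [/\ (K <= L)%N,
        partition [set: 'I_K] S [set: G],
        forall k : 'I_K, syndetic (S k) &
        forall k : 'I_K,
          opnorm (bop_comp (diag_proj (S k)) (bop_comp X (diag_proj (S k))))
            <= eps * opnorm X].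
Proof.
have [c cA] := partition_coloring _ A_partition.
have [l|K [c' [KL syn c'X]]] := syndetic_coloring X (eps * opnorm X) L c X_VN.
  by rewrite cA; exact: A_paving.
exists K, (fun k => c' @^-1` [set k]); split=> //.
by apply: coloring_partition => k; exact: syndetic_nonempty.
Qed.
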